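(* Let $M$ be a graded module of formal vector fields as in the context, and let $X=X_0+\cdots\in M$ be a vector field whose initial part $X_0$ is quasi-homogeneous of degree $\delta_0$. Put $B_K^1=\{[X_0,Z] : Z\in M\}\subset M$, and let $V$ be a complement of $B_K^1$ in $M$. Then there exist a vector field $Y$ belonging to $V$ and a formal diffeomorphism $\Phi$ such that $$\Phi^*X=X_0+Y .$$
   Context: Let $p=(p_1,\dots,p_n)$ be fixed relatively prime positive integers and $R=\sum_i p_i x_i\,\partial/\partial x_i$. A polynomial vector field $Z$ is quasi-homogeneous of degree $k$ if $[R,Z]=kZ$ (so $x^m\partial/\partial x_i$ has degree $\sum_j p_jm_j-p_i$). $\widehat{\mathcal O}_n=\mathbb C[[x_1,\dots,x_n]]$. $M$ is an $\widehat{\mathcal O}_n$-submodule of the module of formal vector fields, graded by the quasi-homogeneity degree, $M=\oplus_k M_k$, where $M_k$ consists of the elements of $M$ that are quasi-homogeneous of degree $k$. The operator $d^0=\mathrm{ad}_{X_0}=[X_0,\cdot]$ is considered as an operator $M\to M$, and $B_K^1$ is its image. $X=X_0+\cdots$ means that the remaining terms of $X$ have quasi-homogeneity degree greater than that of $X_0$. $\Phi^*X=(D\Phi)^{-1}\cdot (X\circ\Phi)$ denotes the pull-back.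
   Formalization: The formal theorem assumes that [W,Z] is in M for every quasi-homogeneous W in M and every Z in M (not only for W = X_0), and that the complement V is graded by quasi-homogeneity degree; without either assumption the claim fails. *)

(* Defs.v *)
From HB Require Import structures.
From mathcomp Require Import all_boot all_order all_algebra.
From mathcomp Require Import boolp classical_sets.
From mathcomp Require Import mpoly.

Set Implicit Arguments.
Unset Strict Implicit.
Unset Printing Implicit Defensive.

Import Order.TTheory GRing.Theory Num.Theory.
Local Open Scope classical_set_scope.
Local Open Scope ring_scope.

(* The ring K[[x_1, ..., x_n]]: a series is its family of coefficients,       *)
(* indexed by the monomials 'X_{1..n} of the multinomials library.            *)

Record fps (K : Type) (n : nat) := Fps { fpscoef :> 'X_{1..n} -> K }.

HB.instance Definition _ (K : choiceType) n := [isNew for @fpscoef K n].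
HB.instance Definition _ (K : choiceType) n := [Choice of fps K n by <:].

Lemma fpsP (K : Type) n (f g : fps K n) : (forall m, f m = g m) <-> f = g.
Proof.
by split=> [|-> //]; case: f g => f [g] fg; congr Fps; apply/funext.
Qed.

Section RingStructure.
Variables (K : comNzRingType) (n : nat).
Implicit Types f g h : fps K n.

Definition fps_add f g := Fps (fun m => f m + g m).
Definition fps_opp f := Fps (fun m => - f m).
Definition fpsC (c : K) : fps K n := Fps (fun m => if m == 0%MM then c else 0).

Lemma fps_addA : associative fps_add.
Proof. by move=> f g h; apply/fpsP => m /=; rewrite addrA. Qed.
Lemma fps_addC : commutative fps_add.
Proof. by move=> f g; apply/fpsP => m /=; rewrite addrC. Qed.
Lemma fps_add0 : left_id (fpsC 0) fps_add.
Proof. by move=> f; apply/fpsP => m /=; rewrite if_same add0r. Qed.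
Lemma fps_addN : left_inverse (fpsC 0) fps_opp fps_add.
Proof. by move=> f; apply/fpsP => m /=; rewrite if_same addNr. Qed.

HB.instance Definition _ :=
  GRing.isZmodule.Build (fps K n) fps_addA fps_addC fps_add0 fps_addN.

Definition fps_mul f g : fps K n := Fps (fun m =>
  \sum_(k : 'X_{1..n < (mdeg m).+1} | (k <= m)%MM) f k * g (m - k)%MM).

(* Truncation to total degree < d reduces the ring axioms to those of         *)
(* {mpoly K[n]}.                                                              *)
Definition fps_trunc d f : {mpoly K[n]} :=
  \sum_(m : 'X_{1..n < d}) f m *: 'X_[m].

Lemma fps_truncE d f m : (mdeg m < d)%N -> (fps_trunc d f)@_m = f m.
Proof. exact: mcoeff_mpoly. Qed.

Lemma mcoeffM_eq (p p' q q' : {mpoly K[n]}) (m : 'X_{1..n}) :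
  (forall k, (k <= m)%MM -> p@_k = p'@_k) ->
  (forall k, (k <= m)%MM -> q@_k = q'@_k) ->
  (p * q)@_m = (p' * q')@_m.
Proof.
move=> ep eq; rewrite !(mcoeff_poly_mul_lin _ _ (ltnSn (mdeg m))).
apply: eq_bigr => k km; rewrite ep // eq //.
by apply/mnm_lepP => i; rewrite mnmBE leq_subr.
Qed.

Lemma lem_mdegS (k m : 'X_{1..n}) d :
  (k <= m)%MM -> (mdeg m < d)%N -> (mdeg k < d)%N.
Proof.
move=> /mnm_lepP km; apply: leq_ltn_trans.
by rewrite !mdegE; apply: leq_sum => i _; apply: km.
Qed.

Lemma fps_mulE d f g m : (mdeg m < d)%N ->
  fps_mul f g m = (fps_trunc d f * fps_trunc d g)@_m.
Proof.
move=> md; rewrite (mcoeff_poly_mul_lin _ _ (ltnSn (mdeg m))) /=.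
apply: eq_bigr => k km; rewrite !fps_truncE //; last exact: lem_mdegS md.
by apply: lem_mdegS md; apply/mnm_lepP => i; rewrite mnmBE leq_subr.
Qed.

Lemma fps_mulA : associative fps_mul.
Proof.
move=> f g h; apply/fpsP => m; set d := (mdeg m).+1.
have md : (mdeg m < d)%N by [].
rewrite !(fps_mulE _ _ md).
have tM u v k : (k <= m)%MM ->
    (fps_trunc d (fps_mul u v))@_k = (fps_trunc d u * fps_trunc d v)@_k.
  move=> km; have kd := lem_mdegS km md.
  by rewrite fps_truncE // (fps_mulE _ _ kd).
rewrite (@mcoeffM_eq _ (fps_trunc d f) _ (fps_trunc d g * fps_trunc d h)) //.
  by rewrite mulrA; apply: mcoeffM_eq => // k /tM ->.
by move=> k /tM.
Qed.

Lemma fps_mulC : commutative fps_mul.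
Proof.
by move=> f g; apply/fpsP => m; rewrite !(fps_mulE _ _ (ltnSn _)) mulrC.
Qed.

Lemma fps_mul1 : left_id (fpsC 1) fps_mul.
Proof.
move=> f; apply/fpsP => m; rewrite (fps_mulE _ _ (ltnSn _)).
rewrite (@mcoeffM_eq _ 1 _ (fps_trunc (mdeg m).+1 f)) //.
  by rewrite mul1r fps_truncE.
move=> k km; rewrite fps_truncE ?(lem_mdegS km) //= mcoeff1.
by case: eqP.
Qed.

Lemma fps_mulDl : left_distributive fps_mul fps_add.
Proof.
move=> f g h; apply/fpsP => m /=; rewrite -big_split /=.
by apply: eq_bigr => k _; rewrite mulrDl.
Qed.

Lemma fps_1neq0 : fpsC 1 != 0.
Proof. by apply/eqP => /fpsP /(_ 0%MM) /= /eqP; rewrite eqxx oner_eq0. Qed.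

HB.instance Definition _ := GRing.Zmodule_isComNzRing.Build (fps K n)
  fps_mulA fps_mulC fps_mul1 fps_mulDl fps_1neq0.

Definition fps_unit : pred (fps K n) := fun f => `[< exists g, g * f = 1 >].
Definition fps_inv f : fps K n :=
  if pselect (exists g, g * f = 1) is left e then sval (cid e) else f.

Lemma fps_mulV : {in fps_unit, left_inverse 1 fps_inv *%R}.
Proof.
move=> f /asboolP uf; rewrite /fps_inv; case: pselect => // e.
by case: cid.
Qed.
Lemma fps_unitP f g : g * f = 1 -> fps_unit f.
Proof. by move=> e; apply/asboolP; exists g. Qed.
Lemma fps_inv_out : {in [predC fps_unit], fps_inv =1 id}.
Proof.
move=> f; rewrite inE => /asboolPn nuf; rewrite /fps_inv.
by case: pselect => // /nuf.
Qed.

HB.instance Definition _ := GRing.ComNzRing_hasMulInverse.Build (fps K n)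
  fps_mulV fps_unitP fps_inv_out.

Definition fpsX (i : 'I_n) : fps K n :=
  Fps (fun m => if m == U_(i)%MM then 1 else 0).

Definition fps_deriv (i : 'I_n) f : fps K n :=
  Fps (fun m => f (m + U_(i))%MM *+ (m i).+1).

(* f(Phi_1, ..., Phi_n), for Phi without constant term: Phi^a then has order  *)
(* at least |a|, so only the monomials x^a of f with |a| <= |m| contribute to *)
(* the coefficient of x^m. (Meaningless if some Phi_i has a constant term.)   *)
Definition fps_comp f (Phi : 'cV[fps K n]_n) : fps K n := Fps (fun m =>
  \sum_(a : 'X_{1..n < (mdeg m).+1}) f a * (\prod_i Phi i 0 ^+ a i) m).

End RingStructure.

Section VectorFields.
Variables (K : fieldType) (n : nat).

(* The column Z stands for the formal vector field \sum_i Z_i d/dx_i.         *)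
Notation vfield := ('cV[fps K n]_n).
Implicit Types (X Y Z : vfield) (M V B : set vfield).

Definition jacobian (F : vfield) : 'M[fps K n]_n :=
  \matrix_(i, j) fps_deriv j (F i 0).

(* [X, Y]_i = X(Y_i) - Y(X_i) *)
Definition bracket X Y : vfield := jacobian Y *m X - jacobian X *m Y.

Definition formal_diffeo (Phi : vfield) : Prop :=
  (forall i, Phi i 0 0%MM = 0) /\
  map_mx (fun f : fps K n => f 0%MM) (jacobian Phi) \in unitmx.

Definition pullback (Phi X : vfield) : vfield :=
  invmx (jacobian Phi) *m map_mx (fun f => fps_comp f Phi) X.

Section Grading.
Variable p : 'I_n -> nat.

Definition euler : vfield := \col_i (fpsX K i *+ p i).

(* Since the p_i are positive, such a Z is automatically polynomial.          *)
Definition qhomog (k : int) Z : Prop := bracket euler Z = Z *~ k.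

(* The part of degree k of Z: x^m d/dx_i has degree \sum_j p_j m_j - p_i.     *)
Definition qpart (k : int) Z : vfield := \col_i Fps (fun m =>
  if (\sum_j p j * m j)%:Z - (p i)%:Z == k then Z i 0 m else 0).

Definition homog_part M (k : int) : set vfield :=
  [set Z | M Z /\ qhomog k Z].

(* M = (+)_k M_k. For formal vector fields the direct sum is the completed    *)
(* one: the elements of M are the formal sums \sum_k Z_k with Z_k in M_k, and *)
(* the terms of such a sum are the qpart k Z.                                 *)
Definition graded M : Prop :=
  forall Z, M Z <-> forall k, homog_part M k (qpart k Z).

End Grading.

Definition submodule M : Prop :=
  [/\ M 0, forall Y Z, M Y -> M Z -> M (Y + Z)
    & forall (f : fps K n) Z, M Z -> M (f *: Z)].

Definition subspace V : Prop :=
  [/\ V 0, forall Y Z, V Y -> V Z -> V (Y + Z)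
    & forall (c : K) Z, V Z -> V (fpsC n c *: Z)].

Definition complement M B V : Prop :=
  [/\ V `<=` M, V `&` B = [set 0]
    & forall Z, M Z -> exists Y W, [/\ V Y, B W & Z = Y + W]].

End VectorFields.

(* Main.v *)
From HB Require Import structures.
Require Import Defs.
From mathcomp Require Import all_boot all_order all_algebra.
From mathcomp Require Import boolp classical_sets reals complex mpoly.
From mathcomp Require Import zify ring.

(** The normal form is reached by a single exponential. For a formal vector
    field Z all of whose terms have degree at least 1, the Lie series e^{L_Z}
    is an automorphism of the ring of formal power series; it is the
    substitution f |-> f o Phi with Phi_i = e^{L_Z} x_i, and
    L_{e^{ad Z} U} e^{L_Z} = e^{L_Z} L_U for every U. Evaluated at the
    coordinates, this says DPhi . e^{ad Z} U = U o Phi: the constant fields U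
    show that DPhi is invertible, and U = X gives Phi^* X = e^{ad Z} X.

    In degree delta0 + N the field e^{ad Z} X is [Z_N, X0] plus terms that
    involve only Z_1, ..., Z_{N-1} and lie in M, so Z_N in M can be chosen
    recursively to put that part of e^{ad Z} X in V. *)

Set Implicit Arguments.
Unset Strict Implicit.
Unset Printing Implicit Defensive.

Import Order.TTheory GRing.Theory Num.Theory.
Local Open Scope classical_set_scope.
Local Open Scope ring_scope.

(** * Formal power series: coefficients and partial derivatives *)

Section PowerSeries.
Variables (K : comNzRingType) (n : nat).
Implicit Types f g : fps K n.

Lemma fps0E m : (0 : fps K n) m = 0.
Proof. by rewrite /= if_same. Qed.

Lemma fps_sumE (I : Type) (r : seq I) (P : pred I) (F : I -> fps K n) m :
  (\sum_(i <- r | P i) F i) m = \sum_(i <- r | P i) F i m.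
Proof. by apply: (big_morph (fun f : fps K n => f m)) => //; exact: fps0E. Qed.

Lemma fpsB m f g : (f - g) m = f m - g m.
Proof. by []. Qed.

Lemma fps_mulrnE f k m : (f *+ k) m = f m *+ k.
Proof.
by elim: k => [|k IH]; [rewrite !mulr0n fps0E | rewrite !mulrS -IH].
Qed.

Lemma fpsMcoefE f g m : (f * g) m = fps_mul f g m.
Proof. by []. Qed.

Lemma fps_mulCE c f m : (fpsC n c * f) m = c * f m.
Proof.
rewrite fpsMcoefE (fps_mulE _ _ (ltnSn _)).
rewrite (@mcoeffM_eq _ _ _ c%:MP _ (fps_trunc (mdeg m).+1 f)) //.
  by rewrite mcoeffCM fps_truncE.
move=> k km; rewrite fps_truncE ?(lem_mdegS km) //= mcoeffC.
by case: eqP => _; rewrite ?mulr1 ?mulr0.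
Qed.

Lemma fps_mul_neq0 f g m : (f * g) m <> 0 ->
  exists k : 'X_{1..n}, [/\ (k <= m)%MM, f k <> 0 & g (m - k)%MM <> 0].
Proof.
rewrite fpsMcoefE /= => fg; apply: contrapT => nex; apply: fg.
apply: big1 => k km; apply: contrapT => kN; apply: nex; exists k; split => //.
  by move=> fk; apply: kN; rewrite fk mul0r.
by move=> gk; apply: kN; rewrite gk mulr0.
Qed.

(** This embedding carries polynomial identities over to series and lets [flow_compE] treat a
    truncation as a series. *)
Definition fps_of_mpoly (q : {mpoly K[n]}) : fps K n := Fps (fun m => q@_m).

Lemma fps_of_mpoly_is_zmod_morphism : zmod_morphism fps_of_mpoly.
Proof. by move=> q r; apply/fpsP => m /=; rewrite mcoeffB. Qed.

Lemma fps_of_mpoly_is_monoid_morphism : monoid_morphism fps_of_mpoly.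
Proof.
split=> [|q r]; first by apply/fpsP => m /=; rewrite mcoeff1; case: eqP.
apply/fpsP => m; rewrite fpsMcoefE (fps_mulE _ _ (ltnSn _)) /=.
by apply: mcoeffM_eq => k km; rewrite fps_truncE ?(lem_mdegS km).
Qed.

HB.instance Definition _ := GRing.isZmodMorphism.Build
  {mpoly K[n]} (fps K n) fps_of_mpoly fps_of_mpoly_is_zmod_morphism.
HB.instance Definition _ := GRing.isMonoidMorphism.Build
  {mpoly K[n]} (fps K n) fps_of_mpoly fps_of_mpoly_is_monoid_morphism.

Lemma fps_of_mpolyX i : fps_of_mpoly 'X_i = fpsX K i.
Proof. by apply/fpsP => m /=; rewrite mcoeffX eq_sym; case: eqP. Qed.

Lemma fps_of_mpolyC c : fps_of_mpoly c%:MP = fpsC n c.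
Proof.
by apply/fpsP => m /=; rewrite mcoeffC; case: eqP; rewrite ?mulr1 ?mulr0.
Qed.

Lemma fps_of_mpolyXm a :
  fps_of_mpoly 'X_[a] = \prod_(i < n) fpsX K i ^+ a i.
Proof.
rewrite mpolyXE_id rmorph_prod; apply: eq_bigr => i _.
by rewrite rmorphXn /= fps_of_mpolyX.
Qed.

Lemma fps_of_mpoly_trunc d f : fps_of_mpoly (fps_trunc d f) =
  \sum_(a : 'X_{1..n < d}) fpsC n (f a) * \prod_(i < n) fpsX K i ^+ a i.
Proof.
rewrite /fps_trunc raddf_sum; apply: eq_bigr => a _ /=.
by rewrite -mul_mpolyC rmorphM /= fps_of_mpolyC fps_of_mpolyXm.
Qed.

Lemma fpsC_mul (c d : K) : fpsC n (c * d) = fpsC n c * fpsC n d.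
Proof. by rewrite -!fps_of_mpolyC mpolyCM rmorphM. Qed.

Lemma fpsC1 : fpsC n 1 = 1 :> fps K n.
Proof. by []. Qed.

Lemma fpsC_nat k : fpsC n k%:R = k%:R :> fps K n.
Proof. by rewrite -fps_of_mpolyC mpolyC_nat rmorph_nat. Qed.

Lemma fps_deriv_is_zmod_morphism i : zmod_morphism (@fps_deriv K n i).
Proof. by move=> f g; apply/fpsP => m /=; rewrite mulrnBl. Qed.

HB.instance Definition _ i := GRing.isZmodMorphism.Build
  (fps K n) (fps K n) (@fps_deriv K n i) (fps_deriv_is_zmod_morphism i).

Lemma fps_derivM i f g :
  fps_deriv i (f * g) = fps_deriv i f * g + f * fps_deriv i g.
Proof.
(* The derivative at [m] reads coefficients of total degree [mdeg m + 1], which the truncation must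
   keep. *)
apply/fpsP => m; set d := (mdeg m).+2.
rewrite -[LHS]/(fps_mul f g (m + U_(i))%MM *+ (m i).+1).
rewrite -[RHS]/(fps_mul _ g m + fps_mul f _ m).
have md : (mdeg (m + U_(i))%MM < d)%N by rewrite mdegD mdeg1 addn1.
rewrite (fps_mulE _ _ md) -mcoeff_mderiv mderivM mcoeffD.
have md' : (mdeg m < d)%N by rewrite /d; lia.
have tD h k : (k <= m)%MM ->
    ((fps_trunc d h)^`M(i))@_k = (fps_trunc d (fps_deriv i h))@_k.
  move=> km; have kd := lem_mdegS km (ltnSn _).
  rewrite mcoeff_mderiv !fps_truncE //; first by rewrite /d; lia.
  by rewrite mdegD mdeg1 /d; lia.
by congr (_ + _); rewrite (fps_mulE _ _ md'); apply: mcoeffM_eq => // k /tD.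
Qed.

Lemma fps_derivC i c : fps_deriv i (fpsC n c) = 0 :> fps K n.
Proof.
apply/fpsP => m; rewrite fps0E /=; case: eqP => [/(congr1 (@mdeg n))|_].
  by rewrite mdegD mdeg1 mdeg0 addn1.
by rewrite mul0rn.
Qed.

Lemma fps_derivX i j : fps_deriv i (fpsX K j) = (i == j)%:R :> fps K n.
Proof.
apply/fpsP => m; rewrite -fps_of_mpolyX -fpsC_nat /= mcoeffX.
case: (eqVneq m 0%MM) => [->|m0].
  rewrite add0m mnm0E mulr1n; case: (eqVneq i j) => [->|ij]; rewrite ?eqxx //.
  by case: eqP => // /mnmP /(_ i); rewrite !mnm1E eqxx eq_sym (negPf ij).
case: eqP => [/(congr1 (@mdeg n))|_]; last by rewrite mul0rn.
rewrite mdegD !mdeg1 => /eqP; rewrite -{1}[1%N]add0n eqn_add2r eq_sym mdeg_eq0.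
by rewrite (negPf m0).
Qed.

Lemma fps_derivC2 i j f :
  fps_deriv i (fps_deriv j f) = fps_deriv j (fps_deriv i f).
Proof.
apply/fpsP => m /=; rewrite -!mulrnA -!addmA [(U_(j) + _)%MM]addmC.
congr (_ *+ _); rewrite !mnmDE !mnm1E [j == i]eq_sym.
by case: eqVneq => [->|_] //; rewrite !addn0 mulnC.
Qed.

End PowerSeries.

(** * Lie derivatives and the Lie bracket *)

Section LieDerivative.
Variables (K : fieldType) (n : nat).
Implicit Types (f g : fps K n) (X Y Z : 'cV[fps K n]_n).

Definition lie Z f : fps K n := \sum_j Z j 0 * fps_deriv j f.

Lemma lie_is_zmod_morphism Z : zmod_morphism (lie Z).
Proof.
move=> f g; rewrite /lie -sumrB; apply: eq_bigr => j _.
by rewrite raddfB mulrBr.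
Qed.

HB.instance Definition _ Z := GRing.isZmodMorphism.Build
  (fps K n) (fps K n) (lie Z) (lie_is_zmod_morphism Z).

Lemma lieBl Y Z f : lie (Y - Z) f = lie Y f - lie Z f.
Proof. by rewrite /lie -sumrB; apply: eq_bigr => j _; rewrite !mxE mulrBl. Qed.

Lemma lieM Z f g : lie Z (f * g) = lie Z f * g + f * lie Z g.
Proof.
rewrite /lie mulr_suml mulr_sumr -big_split; apply: eq_bigr => j _ /=.
by rewrite fps_derivM; ring.
Qed.

Lemma lieC Z c : lie Z (fpsC n c) = 0.
Proof. by rewrite /lie big1 // => j _; rewrite fps_derivC mulr0. Qed.

Lemma lieX Z i : lie Z (fpsX K i) = Z i 0.
Proof.
rewrite /lie (bigD1 i) //= big1 => [|j ji]; rewrite fps_derivX.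
  by rewrite eqxx mulr1 addr0.
by rewrite (negPf ji) mulr0.
Qed.

Lemma mul_jacobianE F Z i : (jacobian F *m Z) i 0 = lie Z (F i 0).
Proof.
by rewrite mxE; apply: eq_bigr => j _; rewrite mxE mulrC.
Qed.

Lemma bracketE X Y i : bracket X Y i 0 = lie X (Y i 0) - lie Y (X i 0).
Proof. by rewrite -!mul_jacobianE /bracket !mxE. Qed.

(** The second-order terms of the two compositions cancel because partial derivatives commute. *)
Lemma lie_bracket X Y f :
  lie (bracket X Y) f = lie X (lie Y f) - lie Y (lie X f).
Proof.
have lie2 U W : lie U (lie W f) =
    \sum_j lie U (W j 0) * fps_deriv j f +
    \sum_j \sum_i W j 0 * U i 0 * fps_deriv i (fps_deriv j f).
  rewrite {2}/lie raddf_sum -big_split; apply: eq_bigr => j _ /=.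
  rewrite lieM; congr (_ + _); rewrite /lie mulr_sumr.
  by apply: eq_bigr => i _; rewrite mulrA.
rewrite !lie2 [X in _ = _ + X - _]exchange_big /=.
have -> : \sum_j \sum_i Y i 0 * X j 0 * fps_deriv j (fps_deriv i f) =
    \sum_j \sum_i X j 0 * Y i 0 * fps_deriv i (fps_deriv j f).
  apply: eq_bigr => j _; apply: eq_bigr => i _.
  by rewrite fps_derivC2 (mulrC (Y i 0)).
rewrite opprD addrACA subrr addr0 -sumrB; apply: eq_bigr => j _.
by rewrite bracketE mulrBl.
Qed.

Lemma bracketBr X Y Z : bracket X (Y - Z) = bracket X Y - bracket X Z.
Proof.
by apply/colP => i; rewrite !(bracketE, mxE) raddfB lieBl /=; ring.
Qed.

Lemma bracketC X Y : bracket X Y = - bracket Y X.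
Proof. by rewrite /bracket opprB. Qed.

Lemma bracketBl X Y Z : bracket (X - Y) Z = bracket X Z - bracket Y Z.
Proof.
by apply/colP => i; rewrite !(bracketE, mxE) raddfB lieBl /=; ring.
Qed.

Lemma bracket0l Z : bracket 0 Z = 0.
Proof. by have := bracketBl Z Z Z; rewrite !subrr. Qed.

Lemma bracketDl X Y Z : bracket (X + Y) Z = bracket X Z + bracket Y Z.
Proof.
by rewrite -{1}[Y]opprK -[- Y]sub0r !bracketBl bracket0l sub0r opprK.
Qed.

End LieDerivative.

(** * Supports with respect to a weighted degree *)

Section Support.
Variables (K : fieldType) (n : nat) (w : 'I_n -> nat).
Implicit Types (S T U : int -> Prop) (m : 'X_{1..n}).
Implicit Types (f g : fps K n) (X Y Z : 'cV[fps K n]_n).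

(** Weights [p] give the quasi-homogeneous degree, weights 1 the total degree. Values are integers
    so that the weight of a component can be subtracted. *)
Definition wdeg m : int := (\sum_j w j * m j)%N%:Z.

(* Orders of vanishing (S = from a), homogeneity (S = eq k) and the absence of
   a degree (S = fun a => a <> k) are all instances of these two predicates. *)
Definition fsupp S f : Prop := forall m, f m <> 0 -> S (wdeg m).

Definition vsupp S Z : Prop :=
  forall i m, Z i 0 m <> 0 -> S (wdeg m - (w i)%:Z).

Lemma wdegD m1 m2 : wdeg (m1 + m2)%MM = wdeg m1 + wdeg m2.
Proof.
rewrite /wdeg -PoszD -big_split; congr Posz; apply: eq_bigr => j _.
by rewrite mnmDE mulnDr.
Qed.

Lemma wdeg1 i : wdeg U_(i)%MM = w i.
Proof.
rewrite /wdeg (bigD1 i) //= big1 => [|j ji]; rewrite mnm1E.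
  by rewrite eqxx muln1 addn0.
by rewrite eq_sym (negPf ji) muln0.
Qed.

Lemma wdeg_ge0 m : 0 <= wdeg m. Proof. by []. Qed.

Lemma fsuppW S T f : fsupp S f -> (forall a, S a -> T a) -> fsupp T f.
Proof. by move=> Sf ST m /Sf /ST. Qed.

Lemma fsupp0 S : fsupp S 0.
Proof. by move=> m; rewrite fps0E. Qed.

Lemma fsuppB S f g : fsupp S f -> fsupp S g -> fsupp S (f - g).
Proof.
move=> Sf Sg m; rewrite fpsB.
have [f0|/eqP/Sf //] := eqVneq (f m) 0; have [g0|/eqP/Sg //] := eqVneq (g m) 0.
by rewrite f0 g0 subr0.
Qed.

Lemma fsuppD S f g : fsupp S f -> fsupp S g -> fsupp S (f + g).
Proof.
move=> Sf Sg; rewrite -[g]opprK; apply: fsuppB => //.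
by rewrite -[- g]sub0r; apply: fsuppB => //; exact: fsupp0.
Qed.

Lemma fsupp_sum S (I : Type) (r : seq I) (P : pred I) (F : I -> fps K n) :
  (forall i, P i -> fsupp S (F i)) -> fsupp S (\sum_(i <- r | P i) F i).
Proof.
by move=> SF; apply: big_ind => //; [exact: fsupp0 | move=> f g; exact: fsuppD].
Qed.

Lemma fsuppM S T U f g : fsupp S f -> fsupp T g ->
  (forall a b, S a -> T b -> U (a + b)) -> fsupp U (f * g).
Proof.
move=> Sf Tg STU m /fps_mul_neq0[k [km /Sf Sk /Tg Tk]].
by rewrite -(submK km) addmC wdegD; exact: STU.
Qed.

Lemma fsupp_deriv S f i :
  fsupp S f -> fsupp (fun a => S (a + (w i)%:Z)) (fps_deriv i f).
Proof.
move=> Sf m /= fm; rewrite -wdeg1 -wdegD; apply: Sf => f0.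
by apply: fm; rewrite f0 mul0rn.
Qed.

Lemma fsupp_lie S T U Z f : vsupp S Z -> fsupp T f ->
  (forall a b, S a -> T b -> U (a + b)) -> fsupp U (lie Z f).
Proof.
move=> SZ Tf STU; apply: fsupp_sum => j _.
have Sj : fsupp (fun a => S (a - (w j)%:Z)) (Z j 0) := SZ j.
have Tj := fsupp_deriv (i := j) Tf.
apply: (fsuppM Sj Tj) => a b Sa Tb.
(* Differentiating along [x_j] lowers the degree by [w j], which is what the component [Z j 0]
   carries beyond the degree of the field. *)
have -> : a + b = a - (w j)%:Z + (b + (w j)%:Z) by lia.
exact: STU.
Qed.

Lemma vsuppE S Z :
  vsupp S Z = (forall i, fsupp (fun a => S (a - (w i)%:Z)) (Z i 0)).
Proof. by []. Qed.

Lemma vsuppW S T Z : vsupp S Z -> (forall a, S a -> T a) -> vsupp T Z.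
Proof. by move=> SZ ST i m /SZ /ST. Qed.

Lemma vsupp0 S : vsupp S 0.
Proof. by move=> i m; rewrite mxE fps0E. Qed.

Lemma vsuppB S Y Z : vsupp S Y -> vsupp S Z -> vsupp S (Y - Z).
Proof.
move=> SY SZ i m; rewrite !mxE.
exact: (@fsuppB (fun a => S (a - (w i)%:Z)) _ _ (SY i) (SZ i)).
Qed.

Lemma vsuppN S Z : vsupp S Z -> vsupp S (- Z).
Proof. by move=> SZ; rewrite -sub0r; apply: vsuppB => //; exact: vsupp0. Qed.

Lemma vsuppD S Y Z : vsupp S Y -> vsupp S Z -> vsupp S (Y + Z).
Proof. by move=> SY /vsuppN SZ; rewrite -[Z]opprK; exact: vsuppB. Qed.

Lemma vsupp_sum S (I : Type) (r : seq I) (P : pred I)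
    (F : I -> 'cV[fps K n]_n) :
  (forall i, P i -> vsupp S (F i)) -> vsupp S (\sum_(i <- r | P i) F i).
Proof.
by move=> SF; apply: big_ind => //; [exact: vsupp0 | move=> f g; exact: vsuppD].
Qed.

Lemma vsupp_bracket S T U Y Z : vsupp S Y -> vsupp T Z ->
  (forall a b, S a -> T b -> U (a + b)) -> vsupp U (bracket Y Z).
Proof.
move=> SY TZ STU; rewrite vsuppE => i; rewrite bracketE.
have Yi : fsupp (fun a => S (a - (w i)%:Z)) (Y i 0) := SY i.
have Zi : fsupp (fun a => T (a - (w i)%:Z)) (Z i 0) := TZ i.
apply: fsuppB.
  apply: (fsupp_lie SY Zi) => a b Sa Tb.
  by rewrite -addrA; exact: STU.
apply: (fsupp_lie TZ Yi) => a b Ta Sb.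
by rewrite -addrA addrC; apply: STU => //; rewrite addrC.
Qed.

Lemma fsupp_scale S c f : fsupp S f -> fsupp S (fpsC n c * f).
Proof.
move=> Sf m; rewrite fps_mulCE => cf; apply: Sf => f0.
by apply: cf; rewrite f0 mulr0.
Qed.

Lemma vsupp_scale S c Z : vsupp S Z -> vsupp S (fpsC n c *: Z).
Proof.
by rewrite !vsuppE => SZ i; rewrite mxE; apply: fsupp_scale; exact: SZ.
Qed.

End Support.

(** * Quasi-homogeneous fields and homogeneous parts *)

Section QuasiHomogeneousParts.
Variables (K : numFieldType) (n : nat) (p : 'I_n -> nat).
Implicit Types (f g : fps K n) (X Y Z : 'cV[fps K n]_n).

Lemma fpsXM_deriv j f m : (fpsX K j * fps_deriv j f) m = f m *+ m j.
Proof.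
have [mj|mj] := posnP (m j).
  rewrite mj mulr0n; apply: contrapT.
  move=> /fps_mul_neq0[k [/mnm_lepP/(_ j) km + _]].
  rewrite /=; case: eqP => // kE; move: km.
  by rewrite kE mnm1E eqxx mj.
have Um : (U_(j) <= m)%MM.
  by apply/mnm_lepP => i; rewrite mnm1E; case: eqP => [<-|].
rewrite fpsMcoefE (fps_mulE _ _ (ltnSn _)).
rewrite (@mcoeffM_eq _ _ _ 'X_j _ (fps_trunc (mdeg m).+1 (fps_deriv j f))) //.
  rewrite mulrC -[X in mcoeff X _](submK Um).
    rewrite addmC mcoeffMX fps_truncE /=.
    by rewrite submK // mnmBE mnm1E eqxx subn1 prednK.
  by rewrite ltnS !mdegE; apply: leq_sum => i _; rewrite mnmBE leq_subr.
move=> k km; rewrite fps_truncE ?(lem_mdegS km) //= mcoeffX eq_sym.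
by case: eqP.
Qed.

Lemma bracket_eulerE Z i m :
  bracket (euler K p) Z i 0 m = Z i 0 m *~ (wdeg p m - (p i)%:Z).
Proof.
rewrite bracketE fpsB mulrzBr; congr (_ - _); last first.
  by rewrite mxE raddfMn /= lieX fps_mulrnE.
rewrite /lie fps_sumE /wdeg -pmulrn -sumrMnr; apply: eq_bigr => j _.
by rewrite mxE mulrnAl fps_mulrnE fpsXM_deriv -mulrnA mulnC.
Qed.

(** Bracketing with the Euler field is diagonal on the fields [x^m d/dx_i], with their degree as
    eigenvalue; characteristic zero keeps distinct degrees distinct in [K]. *)
Lemma qhomogP k Z : qhomog p k Z <-> vsupp p (eq k) Z.
Proof.
have ZkE i m : (Z *~ k) i 0 m = Z i 0 m *~ k.
  case: k => k; first by rewrite -!pmulrn mulmxnE fps_mulrnE.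
  by rewrite !NegzE !mulrNz -!pmulrn mxE mulmxnE /= fps_mulrnE.
split=> [hZ i m Zm|hZ].
  have := bracket_eulerE Z i m; rewrite (hZ : _ = _) ZkE.
  move=> /eqP; rewrite -subr_eq0 -mulrzBr mulrz_eq0 subr_eq0.
  by move=> /orP[/eqP //|/eqP].
apply/colP => i; apply/fpsP => m; rewrite bracket_eulerE ZkE.
have [->|/eqP/hZ <- //] := eqVneq (Z i 0 m) 0.
by rewrite !mul0rz.
Qed.

Lemma qpartE k Z i m :
  qpart p k Z i 0 m = if wdeg p m - (p i)%:Z == k then Z i 0 m else 0.
Proof. by rewrite mxE. Qed.

Lemma qpartB k Y Z : qpart p k (Y - Z) = qpart p k Y - qpart p k Z.
Proof.
 apply/colP => i; apply/fpsP => m.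
rewrite !(mxE, qpartE, fpsB) /=; by case: eqP; rewrite ?subr0.
Qed.

Lemma vsupp_qpart k Z : vsupp p (eq k) (qpart p k Z).
Proof. by move=> i m; rewrite qpartE; case: eqP. Qed.

Lemma qpart0 k Z : vsupp p (fun a => a <> k) Z -> qpart p k Z = 0.
Proof.
move=> hZ; apply/colP => i; apply/fpsP => m; rewrite qpartE mxE fps0E.
by case: eqP => // mk; apply: contrapT => /hZ.
Qed.

Lemma vsupp_subqpart k Z : vsupp p (fun a => a <> k) (Z - qpart p k Z).
Proof.
move=> i m; have -> : (Z - qpart p k Z) i 0 m = Z i 0 m - qpart p k Z i 0 m.
  by rewrite !mxE.
by rewrite qpartE; case: eqP => // _; rewrite subrr.
Qed.

Lemma qpart_homog k Z : vsupp p (eq k) Z -> qpart p k Z = Z.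
Proof.
move=> hZ; apply/colP => i; apply/fpsP => m; rewrite qpartE.
by case: eqP => // mk; symmetry; apply: contrapT => /hZ /esym /mk.
Qed.

(** Bracketing with [X] shifts degrees by [d], so the part of [Z] outside degree [k - d] contributes
    nothing to degree [k]. *)
Lemma qpart_bracket k d X Z : vsupp p (eq d) X ->
  qpart p k (bracket X Z) = bracket X (qpart p (k - d) Z).
Proof.
move=> hX; set Zj := qpart p (k - d) Z.
apply/eqP; rewrite -subr_eq0 -[X in _ - X](@qpart_homog k); last first.
  by apply: (vsupp_bracket hX (vsupp_qpart (k := k - d) (Z := Z))) => a b; lia.
rewrite -qpartB -bracketBr qpart0 //.
by apply: (vsupp_bracket hX (vsupp_subqpart (k := k - d) (Z := Z))) => a b; lia.
Qed.

Lemma vsupp_qpart_eq0 (S : int -> Prop) Z :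
  (forall k, ~ S k -> qpart p k Z = 0) -> vsupp p S Z.
Proof.
move=> SZ i m Zm; apply: contrapT => /SZ /colP /(_ i) /fpsP /(_ m).
by rewrite qpartE eqxx mxE fps0E.
Qed.

End QuasiHomogeneousParts.

(** * Divided powers and Cauchy products *)

Lemma zmod_morphismMn (S T : zmodType) (f : S -> T) :
  zmod_morphism f -> forall x k, f (x *+ k) = f x *+ k.
Proof.
(* The maps used later are plain functions, such as partial applications of [mu], so the additive
   structure is packed locally. *)
move=> fB; pose A := GRing.isZmodMorphism.Build S T f fB.
pose fA : {additive S -> T} := HB.pack f A.
move=> x k; exact: (raddfMn fA k x).
Qed.

Lemma zmod_morphism_sum (S T : zmodType) (f : S -> T) :
  zmod_morphism f -> forall (I : Type) (r : seq I) (P : pred I) (F : I -> S),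
  f (\sum_(i <- r | P i) F i) = \sum_(i <- r | P i) f (F i).
Proof.
move=> fB; pose A := GRing.isZmodMorphism.Build S T f fB.
pose fA : {additive S -> T} := HB.pack f A.
move=> I r P F; exact: (raddf_sum fA).
Qed.

Section DividedPowers.

(* u is the sequence D^l x / l!, with the division removed so that it makes
   sense in any abelian group. *)
Definition dpseq (S : zmodType) (D : S -> S) (u : nat -> S) : Prop :=
  forall l, D (u l) = u l.+1 *+ l.+1.

(** Without torsion the recursion determines each term from the previous one. Sequences of divided
    powers are compared this way, without binomial formulas. *)
Lemma dpseq_uniq (S : zmodType) (D : S -> S) (u v : nat -> S) :
  (forall (x : S) l, x *+ l.+1 = 0 -> x = 0) ->
  dpseq D u -> dpseq D v -> u 0%N = v 0%N -> u =1 v.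
Proof.
move=> tf Du Dv uv0; elim=> [|l IH] //; apply/eqP; rewrite -subr_eq0; apply/eqP.
by apply: (tf _ l); rewrite mulrnBl -Du -Dv IH subrr.
Qed.

Variables (S T W : zmodType) (mu : S -> T -> W).
Hypothesis muBl : forall x y z, mu (x - y) z = mu x z - mu y z.
Hypothesis muBr : forall x y z, mu x (y - z) = mu x y - mu x z.

Let mulM x k y : mu (x *+ k) y = mu x y *+ k.
Proof. by rewrite (zmod_morphismMn (f := mu^~ y)). Qed.

Let murM x y k : mu x (y *+ k) = mu x y *+ k.
Proof. by rewrite (zmod_morphismMn (f := mu x)). Qed.

Definition cauchy (u : nat -> S) (v : nat -> T) (l : nat) : W :=
  \sum_(a < l.+1) mu (u a) (v (l - a)%N).

Lemma dpseq_cauchy (DS : S -> S) (DT : T -> T) (DW : W -> W) u v :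
  zmod_morphism DW ->
  (forall x y, DW (mu x y) = mu (DS x) y + mu x (DT y)) ->
  dpseq DS u -> dpseq DT v -> dpseq DW (cauchy u v).
Proof.
move=> DB Dmu Du Dv l; rewrite zmod_morphism_sum //.
under eq_bigr do rewrite Dmu Du Dv.
rewrite big_split /= /cauchy -sumrMnl.
(* The factor [l.+1] splits as [i + (l.+1 - i)], one share for the derivative of each argument of
   [mu]. *)
have -> : \sum_(i < l.+2) mu (u i) (v (l.+1 - i)%N) *+ l.+1 =
  \sum_(i < l.+2) mu (u i) (v (l.+1 - i)%N) *+ i +
  \sum_(i < l.+2) mu (u i) (v (l.+1 - i)%N) *+ (l.+1 - i).
  rewrite -big_split; apply: eq_bigr => i _ /=.
  by rewrite -mulrnDr subnKC // -ltnS.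
congr (_ + _).
  rewrite [RHS]big_ord_recl /= mulr0n add0r; apply: eq_bigr => i _ /=.
  by rewrite /bump leq0n add1n subSS mulM.
rewrite [RHS]big_ord_recr /= subnn mulr0n addr0; apply: eq_bigr => i _ /=.
by rewrite subSn -1?ltnS // murM.
Qed.

(** Both sides sum [mu (u a) (v b)] over the triangle [a + b < N]. *)
Lemma sum_cauchy (u : nat -> S) (v : nat -> T) N :
  \sum_(l < N) cauchy u v l = \sum_(a < N) mu (u a) (\sum_(b < N - a) v b).
Proof.
have mur_sum x k : mu x (\sum_(b < k) v b) = \sum_(b < k) mu x (v b).
  exact: (zmod_morphism_sum (f := mu x)).
elim: N => [|N IH]; first by rewrite !big_ord0.
rewrite big_ord_recr /= IH /cauchy !big_ord_recr /= subnn subSnn big_ord1.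
rewrite addrA; congr (_ + _); rewrite -big_split; apply: eq_bigr => a _ /=.
by rewrite subSn 1?ltnW // !mur_sum big_ord_recr.
Qed.

Variables (FS : int -> S -> Prop) (FT : int -> T -> Prop).
Variable FW : int -> W -> Prop.
Hypothesis FW0 : forall a, FW a 0.
Hypothesis FWD : forall a x y, FW a x -> FW a y -> FW a (x + y).
Hypothesis Fmu : forall a b x y, FS a x -> FT b y -> FW (a + b) (mu x y).

(* Used with mu the product of series, which makes e^{L_Z} multiplicative, and
   with mu U f = L_U f, which gives the intertwining relation; s allows for
   the components of a vector field starting in degree -s. *)
Lemma cauchy_product (s : int) (u : nat -> S) (v : nat -> T) x y :
  (forall N : nat, FS (N%:Z - s) (x - \sum_(l < N) u l)) ->
  (forall l : nat, FS (l%:Z - s) (u l)) ->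
  (forall N : nat, FT N%:Z (y - \sum_(l < N) v l)) ->
  forall N : nat, FW (N%:Z - s) (mu x y - \sum_(l < N) cauchy u v l).
Proof.
move=> xu us yv N; rewrite sum_cauchy.
(* The error is the tail of [x] paired with [y], plus each [u a] paired with the tail of [y] from
   index [N - a] on; every piece has order at least [N - s]. *)
have -> : mu x y - \sum_(a < N) mu (u a) (\sum_(b < N - a) v b) =
  mu (x - \sum_(a < N) u a) y +
  \sum_(a < N) mu (u a) (y - \sum_(b < N - a) v b).
  rewrite muBl (zmod_morphism_sum (f := mu^~ y)) //.
  under [X in _ = _ + X]eq_bigr do rewrite muBr.
  by rewrite sumrB addrA subrK.
apply: FWD.
  have F0 : FT 0 y by have := yv 0%N; rewrite big_ord0 subr0.
  by have := Fmu (xu N) F0; rewrite addr0.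
apply: big_ind => // [|a _]; first exact: FWD.
have := Fmu (us a) (yv (N - a)%N).
by have -> : a%:Z - s + (N - a)%N%:Z = N%:Z - s by have := ltn_ord a; lia.
Qed.

End DividedPowers.

(** * Filtration by degree *)

Lemma sum_ord_widen0 (S : nmodType) (F : nat -> S) N1 N2 :
  (N1 <= N2)%N -> (forall l, (N1 <= l)%N -> F l = 0) ->
  \sum_(l < N2) F l = \sum_(l < N1) F l.
Proof.
move=> N12 F0; rewrite -!(big_mkord xpredT F) (big_cat_nat (n := N1)) //=.
rewrite [X in _ + X]big_nat_cond [X in _ + X]big1 ?addr0 // => l.
by move=> /andP[/andP[/F0]].
Qed.

Definition from (a : int) : int -> Prop := fun b => a <= b.

Section FilteredSeries.
Variables (K : fieldType) (n : nat) (w : 'I_n -> nat).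
Implicit Types (f : fps K n) (Z : 'cV[fps K n]_n).

Lemma from0_fps f : fsupp w (from 0) f.
Proof. by move=> m _; exact: wdeg_ge0. Qed.

(** Component [i] starts in degree at least [- w i]; the sum of the weights gives a bound uniform in
    [i]. *)
Lemma from_bot_vfield Z : vsupp w (from (- (\sum_i w i)%N%:Z)) Z.
Proof.
move=> i m _; rewrite /from; have := wdeg_ge0 w m.
by rewrite (bigD1 i) //=; lia.
Qed.

(** Every coefficient sits in a finite degree. Identities between Lie series can thus be checked
    modulo each order [N], on finite sums. *)
Lemma fps_separated (s : int) f :
  (forall N : nat, fsupp w (from (N%:Z - s)) f) -> f = 0.
Proof.
move=> F; apply/fpsP => m; rewrite fps0E; apply: contrapT => fm.
by have := F (absz (wdeg w m + s + 1)) m fm; rewrite /from; lia.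
Qed.

End FilteredSeries.

(** * Iterated Lie derivatives and brackets divided by factorials *)

Section DividedPowerSequences.
Variables (K : numFieldType) (n : nat).

(** For [D] linear over constants this is [D^l x / l!]. An arbitrary module covers both series and
    vector fields. *)
Fixpoint dpow (S : lmodType (fps K n)) (D : S -> S) (x : S) (l : nat) : S :=
  if l is l'.+1 then fpsC n l'.+1%:R^-1 *: D (dpow D x l') else x.

Lemma dpow_dpseq (S : lmodType (fps K n)) (D : S -> S) x : dpseq D (dpow D x).
Proof.
move=> l /=; rewrite scalerMnl -mulr_natl -fpsC_nat -fpsC_mul.
by rewrite mulfV ?pnatr_eq0 // fpsC1 scale1r.
Qed.

Lemma fps_torsion_free (f : fps K n) l : f *+ l.+1 = 0 -> f = 0.
Proof.
move=> f0; apply/fpsP => m; have /fpsP/(_ m) := f0.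
by rewrite fps_mulrnE !fps0E => /eqP; rewrite mulrn_eq0 /= => /eqP.
Qed.

End DividedPowerSequences.

Section DividedPowersOfDerivations.
Variables (K : numFieldType) (n : nat) (w : 'I_n -> nat).
Implicit Types (f : fps K n) (X Z : 'cV[fps K n]_n).

Definition lie_pow Z f : nat -> fps K n := dpow (S := (fps K n)^o) (lie Z) f.
Lemma lie_powS Z f l :
  lie_pow Z f l.+1 = fpsC n l.+1%:R^-1 * lie Z (lie_pow Z f l).
Proof. by []. Qed.

Definition ad_pow Z X : nat -> 'cV[fps K n]_n := dpow (bracket Z) X.

Lemma fsupp_lie_pow (d a : int) Z f l :
  vsupp w (from d) Z -> fsupp w (from a) f ->
  fsupp w (from (a + d *+ l)) (lie_pow Z f l).
Proof.
move=> Zd fa; elim: l => [|l IH]; first by rewrite mulr0n addr0.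
apply: fsupp_scale; apply: (fsupp_lie Zd IH) => b c; rewrite /from; lia.
Qed.

Lemma vsupp_ad_pow (d a : int) Z X l :
  vsupp w (from d) Z -> vsupp w (from a) X ->
  vsupp w (from (a + d *+ l)) (ad_pow Z X l).
Proof.
move=> Zd Xa; elim: l => [|l IH]; first by rewrite mulr0n addr0.
apply: vsupp_scale; apply: (vsupp_bracket Zd IH) => b c; rewrite /from; lia.
Qed.

End DividedPowersOfDerivations.

(** * The Lie series e^{L_Z} and e^{ad Z} *)

Section Flow.
Variables (K : numFieldType) (n : nat) (p : 'I_n -> nat).
Implicit Types (f g : fps K n) (X Y Z : 'cV[fps K n]_n).

Let P : nat := (\sum_i p i)%N.

(** The Lie series e^{L_Z} f: if [Z] starts in degree 1, the term of index [l] has order at least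
    [l], so the sum at [m] omits only zeros. *)
Definition flow Z f : fps K n :=
  Fps (fun m => \sum_(l < (absz (wdeg p m)).+1) lie_pow Z f l m).

(* The components of X have degree at least - \sum_i p i, so (ad Z)^l X / l!
   reaches the coefficient of x^m d/dx_i only for the listed l. *)
Definition adflow Z X : 'cV[fps K n]_n :=
  \col_i Fps (fun m =>
    \sum_(l < (absz (wdeg p m) + \sum_i p i - p i).+1) ad_pow Z X l i 0 m).

Section FixedGenerator.
Variable Z : 'cV[fps K n]_n.
Hypothesis Z_ge1 : vsupp p (from 1) Z.

Lemma flow_trunc f (N : nat) :
  fsupp p (from N%:Z) (flow Z f - \sum_(l < N) lie_pow Z f l).
Proof.
move=> m fm; rewrite /from leNgt; apply/negP => mN; apply: fm.
rewrite fpsB fps_sumE.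
rewrite -[flow Z f m]/(\sum_(l < (absz (wdeg p m)).+1) lie_pow Z f l m).
rewrite (@sum_ord_widen0 _ (fun l => lie_pow Z f l m)
  (absz (wdeg p m)).+1 N) ?subrr //.
move=> l ml; apply: contrapT.
move=> /(fsupp_lie_pow (l := l) Z_ge1 (from0_fps p (f := f))).
by rewrite /from; have := wdeg_ge0 p m; lia.
Qed.

Lemma adflow_trunc X (N : nat) :
  vsupp p (from (N%:Z - P%:Z)) (adflow Z X - \sum_(l < N) ad_pow Z X l).
Proof.
move=> i m.
have -> : (adflow Z X - \sum_(l < N) ad_pow Z X l) i 0 m =
    \sum_(l < (absz (wdeg p m) + P - p i).+1) ad_pow Z X l i 0 m -
    \sum_(l < N) ad_pow Z X l i 0 m.
  by rewrite !mxE summxE fpsB fps_sumE.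
move=> fm.
rewrite /from leNgt; apply/negP => mN; apply: fm.
have pP : (p i <= P)%N by rewrite /P (bigD1 i) //= leq_addr.
have NP : ((absz (wdeg p m) + P - p i).+1 <= N)%N.
  by have := wdeg_ge0 p m; lia.
rewrite (@sum_ord_widen0 _ (fun l => ad_pow Z X l i 0 m)
  (absz (wdeg p m) + P - p i).+1 N) ?subrr //.
move=> l ml; apply: contrapT.
move=> /(vsupp_ad_pow (l := l) Z_ge1 (from_bot_vfield p (Z := X))).
by rewrite /from -/P; have := wdeg_ge0 p m; lia.
Qed.

(** By the Leibniz rule the divided powers on [f * g] are the Cauchy product of those on [f] and
    [g]; partial sums are then compared modulo every order. *)
Lemma flowM f g : flow Z (f * g) = flow Z f * flow Z g.
Proof.
have powE : lie_pow Z (f * g) =1 cauchy *%R (lie_pow Z f) (lie_pow Z g).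
  apply: (dpseq_uniq (@fps_torsion_free _ _)).
  - exact: (dpow_dpseq (S := (fps K n)^o)).
  - apply: (@dpseq_cauchy _ _ _ _ _ _ (lie Z) (lie Z)).
    + by move=> *; rewrite mulrBl.
    + by move=> *; rewrite mulrBr.
    + exact: raddfB.
    + exact: lieM.
    + exact: (dpow_dpseq (S := (fps K n)^o)).
    + exact: (dpow_dpseq (S := (fps K n)^o)).
  - by rewrite /cauchy big_ord1.
apply/eqP; rewrite eq_sym -subr_eq0; apply/eqP.
apply: (@fps_separated _ _ p 0) => N; rewrite subr0.
rewrite -(subrK (\sum_(l < N) lie_pow Z (f * g) l) (_ * _)) -addrA.
rewrite -[X in fsupp _ _ (_ + X)]opprB; apply: fsuppB.
  under eq_bigr do rewrite powE.
  rewrite -[N%:Z]subr0.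
  apply: (@cauchy_product _ _ _ *%R _ _
    (fun a => fsupp p (from a)) (fun a => fsupp p (from a))
    (fun a => fsupp p (from a))).
  - by move=> *; rewrite mulrBl.
  - by move=> *; rewrite mulrBr.
  - by move=> *; exact: fsupp0.
  - by move=> *; exact: fsuppD.
  - move=> a b x y xa yb; apply: (fsuppM xa yb) => c d; rewrite /from; lia.
  - by move=> k; rewrite subr0; exact: flow_trunc.
  - move=> l; rewrite subr0.
    have := fsupp_lie_pow (l := l) Z_ge1 (from0_fps p (f := f)).
    by rewrite add0r natz.
  - exact: flow_trunc.
exact: flow_trunc.
Qed.

(** The pairing of [U] and [f] into [lie U f] obeys a Leibniz rule, with [bracket Z] acting on [U]
    and [lie Z] on [f], so the argument for products applies. *)
Lemma lie_adflow X f : lie (adflow Z X) (flow Z f) = flow Z (lie X f).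
Proof.
have powE : lie_pow Z (lie X f) =1 cauchy (@lie _ _) (ad_pow Z X) (lie_pow Z f).
  apply: (dpseq_uniq (@fps_torsion_free _ _)).
  - exact: (dpow_dpseq (S := (fps K n)^o)).
  - apply: (@dpseq_cauchy _ _ _ _ _ _ (bracket Z) (lie Z)).
    + exact: lieBl.
    + by move=> *; rewrite raddfB.
    + exact: raddfB.
    + by move=> Y g; rewrite lie_bracket subrK.
    + exact: dpow_dpseq.
    + exact: (dpow_dpseq (S := (fps K n)^o)).
  - by rewrite /cauchy big_ord1.
apply/eqP; rewrite -subr_eq0; apply/eqP.
apply: (@fps_separated _ _ p P%:Z) => N.
rewrite -(subrK (\sum_(l < N) lie_pow Z (lie X f) l) (lie _ _)) -addrA.
rewrite -[X in fsupp _ _ (_ + X)]opprB; apply: fsuppB.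
  under eq_bigr do rewrite powE.
  apply: (@cauchy_product _ _ _ _ _ _
    (fun a => vsupp p (from a)) (fun a => fsupp p (from a))
    (fun a => fsupp p (from a))).
  - exact: lieBl.
  - by move=> *; rewrite raddfB.
  - by move=> *; exact: fsupp0.
  - by move=> *; exact: fsuppD.
  - move=> a b x y xa yb; apply: (fsupp_lie xa yb) => c d; rewrite /from; lia.
  - exact: adflow_trunc.
  - move=> l.
    have := vsupp_ad_pow (l := l) Z_ge1 (from_bot_vfield p (Z := X)).
    by rewrite addrC natz.
  - exact: flow_trunc.
by apply: (fsuppW (@flow_trunc (lie X f) N)) => a; rewrite /from; lia.
Qed.

Lemma flowB f g : flow Z (f - g) = flow Z f - flow Z g.
Proof.
apply/fpsP => m; rewrite fpsB /= -sumrB; apply: eq_bigr => l _.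
rewrite -fpsB; congr (fpscoef _ _).
elim: (l : nat) => [|k IH] //.
by rewrite !lie_powS IH raddfB mulrBr.
Qed.

Lemma flowC c : flow Z (fpsC n c) = fpsC n c.
Proof.
have pow0 l : lie_pow Z (fpsC n c) l.+1 = 0.
  elim: l => [|l IH]; first by rewrite lie_powS lieC mulr0.
  by rewrite lie_powS IH raddf0 mulr0.
apply/fpsP => m.
rewrite -[LHS]/(\sum_(l < (absz (wdeg p m)).+1) lie_pow Z (fpsC n c) l m).
by rewrite big_ord_recl big1 ?addr0 // => l _; rewrite pow0 fps0E.
Qed.

End FixedGenerator.
End Flow.

(** * The constant term as a ring morphism *)

Section ConstantTerm.
Variables (K : comNzRingType) (n : nat).

Definition const_term (f : fps K n) : K := f 0%MM.

Lemma const_term_is_zmod_morphism : zmod_morphism const_term.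
Proof. by []. Qed.

Lemma const_term_is_monoid_morphism : monoid_morphism const_term.
Proof.
split=> [|f g]; first by rewrite /const_term /= eqxx.
rewrite /const_term fpsMcoefE (fps_mulE (d := 1)) ?mdeg0 //.
by rewrite rmorphM /= !fps_truncE ?mdeg0.
Qed.

HB.instance Definition _ := GRing.isZmodMorphism.Build
  (fps K n) K const_term const_term_is_zmod_morphism.
HB.instance Definition _ := GRing.isMonoidMorphism.Build
  (fps K n) K const_term const_term_is_monoid_morphism.

End ConstantTerm.

(** * The formal diffeomorphism generated by [Z] *)

Section FlowMap.
Variables (K : numFieldType) (n : nat) (p : 'I_n -> nat).
Hypothesis p_gt0 : forall i, (0 < p i)%N.
Variable Z : 'cV[fps K n]_n.
Hypothesis Z_ge1 : vsupp p (from 1) Z.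
Implicit Types (f g : fps K n) (X : 'cV[fps K n]_n).

Let phi : fps K n -> fps K n := flow p Z.

Definition flow_map : 'cV[fps K n]_n := \col_i flow p Z (fpsX K i).

Let one : 'I_n -> nat := fun=> 1%N.

Lemma wdeg_one (m : 'X_{1..n}) : wdeg (fun=> 1%N) m = mdeg m :> int.
Proof.
by rewrite /wdeg mdegE; congr Posz; apply: eq_bigr => i _; rewrite mul1n.
Qed.

(** A constant term along [d/dx_i] would have degree [- p i], below 1. *)
Lemma vsupp_one : vsupp one (from 0) Z.
Proof.
move=> i m Zm; rewrite wdeg_one /from /one.
have := Z_ge1 Zm; rewrite /from; have [->|] := eqVneq m 0%MM.
  rewrite /wdeg big1 => [|j _]; last by rewrite mnm0E muln0.
  by have := p_gt0 i; lia.
by rewrite -mdeg_eq0 -lt0n; lia.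
Qed.

(* Z has no constant term, so e^{L_Z} also preserves the order for the total
   degree, which is the one that fps_comp truncates by. *)
Lemma flow_order (a : nat) f :
  fsupp one (from a%:Z) f -> fsupp one (from a%:Z) (phi f).
Proof.
move=> fa m; rewrite /phi => fm.
apply: contrapT => ma; apply: fm; apply: big1 => l _; apply: contrapT.
by move=> /(fsupp_lie_pow (l := l) vsupp_one fa); rewrite mul0rn addr0.
Qed.

Lemma flow_exp f k : phi (f ^+ k) = phi f ^+ k.
Proof.
elim: k => [|k IH]; first by rewrite !expr0 -fpsC1; exact: flowC.
by rewrite !exprS /phi flowM // -/phi IH.
Qed.

(** The flow is multiplicative and fixes constants, so both sides agree on monomials; at [m] only
    the truncation of [f] matters. *)
Lemma flow_compE f : phi f = fps_comp f flow_map.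
Proof.
apply/fpsP => m; set q := fps_trunc (mdeg m).+1 f.
have /eqP : phi (f - fps_of_mpoly q) m = 0.
  have: fsupp one (from (mdeg m).+1%:Z) (f - fps_of_mpoly q).
    move=> k; rewrite fpsB wdeg_one /from => fk; rewrite lez_nat ltnNge.
    by apply/negP => km; apply: fk; rewrite /= fps_truncE ?subrr.
  move=> /flow_order F; apply: contrapT => /F.
  by rewrite wdeg_one /from lez_nat ltnn.
rewrite /phi flowB // fpsB subr_eq0 => /eqP ->.
rewrite /q fps_of_mpoly_trunc (zmod_morphism_sum (@flowB _ _ _ _ )) fps_sumE.
apply: eq_bigr => a _; rewrite flowM // flowC fps_mulCE.
congr (_ * fpscoef _ _).
rewrite (big_morph _ (@flowM _ _ _ _ Z_ge1) (flowC _ _ 1)).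
by apply: eq_bigr => i _; rewrite -/phi flow_exp mxE.
Qed.

Lemma jacobian_flow_map_mul X :
  jacobian flow_map *m adflow p Z X = \col_i phi (X i 0).
Proof.
by apply/colP => i; rewrite mul_jacobianE !mxE lie_adflow // lieX.
Qed.

Lemma jacobian_flow_map_unit : exists J, jacobian flow_map *m J = 1%:M.
Proof.
(* Column [j] is e^{ad Z} applied to the constant field [d/dx_j]; the Jacobian sends it to [d/dx_j],
   since the flow fixes constants. *)
exists (\matrix_(i, j) adflow p Z (delta_mx j 0) i 0).
apply/matrixP => i j; rewrite !mxE.
have /colP/(_ i) := jacobian_flow_map_mul (delta_mx j 0).
rewrite !mxE => E; rewrite (eq_bigr (fun k => jacobian flow_map i k *
  adflow p Z (delta_mx j 0) k 0)) => [|k _]; last by rewrite !mxE.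
by rewrite E eqxx andbT -fpsC_nat /phi flowC.
Qed.

Lemma flow_map_diffeo : formal_diffeo flow_map.
Proof.
split=> [i|].
  rewrite mxE; apply: contrapT; rewrite -/phi.
  have Xi : fsupp one (from 1) (fpsX K i).
    by move=> m /=; case: eqP => // -> _; rewrite wdeg_one mdeg1.
  by move=> /(flow_order Xi); rewrite wdeg_one mdeg0.
have [J JE] := jacobian_flow_map_unit.
(* Constant terms of an inverse over series give an inverse of the linear part. *)
have := congr1 (map_mx (@const_term K n)) JE.
by rewrite map_mxM map_mx1 => /mulmx1_unit[].
Qed.

Lemma pullback_flow_map X : pullback flow_map X = adflow p Z X.
Proof.
have [J /mulmx1_unit[Ju _]] := jacobian_flow_map_unit.
rewrite /pullback -[RHS](mulKmx Ju) jacobian_flow_map_mul; congr (_ *m _).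
by apply/colP => i; rewrite !mxE flow_compE.
Qed.

End FlowMap.

(** * Dependence of e^{ad Z} X on the generator *)

Lemma sub_split2 (S : zmodType) (a b : S) (F G : nat -> S) L : F 0%N = G 0%N ->
  a - b - (F 1%N - G 1%N) =
  (a - \sum_(l < L.+2) F l) - (b - \sum_(l < L.+2) G l) +
  \sum_(l < L) (F l.+2 - G l.+2).
Proof.
move=> FG0; set A := \sum_(l < L.+2) F l; set B := \sum_(l < L.+2) G l.
have -> : a - A - (b - B) = a - b - (A - B).
  by rewrite !opprB [B - b]addrC addrACA [- A + B]addrC.
rewrite -sumrB !big_ord_recl FG0 subrr add0r [in RHS]opprD.
by rewrite addrA subrK.
Qed.

Section Perturbation.
Variables (K : numFieldType) (n : nat) (p : 'I_n -> nat).
Implicit Types (X Y Z : 'cV[fps K n]_n).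

Lemma adflow0 X : adflow p 0 X = X.
Proof.
have pow0 l : ad_pow 0 X l.+1 = 0.
  by rewrite -[LHS]/(fpsC n _ *: bracket 0 _) bracket0l scaler0.
apply/colP => i; apply/fpsP => m; rewrite mxE.
rewrite [LHS]big_ord_recl [X in _ + X]big1 ?addr0 //.
by move=> l _; rewrite pow0 mxE fps0E.
Qed.

Lemma qpart_eq_from (a k : int) Y Z :
  vsupp p (from a) (Y - Z) -> k < a -> qpart p k Y = qpart p k Z.
Proof.
move=> YZ ka; apply/eqP; rewrite -subr_eq0 -qpartB qpart0 //.
by apply: (vsuppW YZ) => b; rewrite /from; lia.
Qed.

Variables (Z Z' X : 'cV[fps K n]_n) (d N : int).
Hypothesis Z_ge1 : vsupp p (from 1) Z.
Hypothesis Z'_ge1 : vsupp p (from 1) Z'.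
Hypothesis ZZ' : vsupp p (from N) (Z - Z').
Hypothesis X_ged : vsupp p (from d) X.

Lemma ad_pow_perturb (l : nat) :
  vsupp p (from (d + N + l%:Z)) (ad_pow Z X l.+1 - ad_pow Z' X l.+1).
Proof.
elim: l => [|l IH].
  rewrite -[ad_pow Z X 1]/(fpsC n 1^-1 *: bracket Z X).
  rewrite -[ad_pow Z' X 1]/(fpsC n 1^-1 *: bracket Z' X).
  rewrite -scalerBr -bracketBl; apply: vsupp_scale.
  apply: (vsupp_bracket ZZ' X_ged) => a b; rewrite /from; lia.
have powS Y : ad_pow Y X l.+2 =
  fpsC n l.+2%:R^-1 *: bracket Y (ad_pow Y X l.+1) by [].
rewrite !powS -scalerBr; apply: vsupp_scale.
(* Telescoping: the first bracket gains a degree from [Z], the second has the order [N] of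
   [Z - Z']. *)
have -> A B :
    bracket Z A - bracket Z' B = bracket Z (A - B) + bracket (Z - Z') B.
  by rewrite bracketBr bracketBl addrA subrK.
apply: vsuppD.
  apply: (vsupp_bracket Z_ge1 IH) => a b; rewrite /from; lia.
apply: (vsupp_bracket ZZ' (vsupp_ad_pow (l := l.+1) Z'_ge1 X_ged)) => a b.
by rewrite /from; lia.
Qed.

(** In degree [d + N] only the term linear in [Z - Z'] survives, which makes the choice of the
    generator recursive. *)
Lemma adflow_perturb :
  vsupp p (from (d + N + 1))
    (adflow p Z X - adflow p Z' X - bracket (Z - Z') X).
Proof.
(* [L] compensates the loss of [P] in [adflow_trunc], so both tails start in degree at least
   [d + N + 1]. *)
set P := (\sum_i p i)%N; set L := (absz (d + N + 1)%R + P)%N.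
have trunc Y : vsupp p (from 1) Y ->
    vsupp p (from (d + N + 1)) (adflow p Y X - \sum_(l < L.+2) ad_pow Y X l).
  move=> Y1; apply: (vsuppW (@adflow_trunc _ _ _ _ Y1 X L.+2)) => a.
  by rewrite /from /L -/P; lia.
clearbody L; have pow1 Y : ad_pow Y X 1 = bracket Y X.
  by rewrite -[ad_pow Y X 1]/(fpsC n 1^-1 *: bracket Y X) invr1 fpsC1 scale1r.
rewrite bracketBl -!pow1.
rewrite (@sub_split2 _ _ _ (ad_pow Z X) (ad_pow Z' X) L) //.
apply: vsuppD; first by apply: vsuppB; exact: trunc.
apply: vsupp_sum => l _; apply: (vsuppW (@ad_pow_perturb l.+1)) => a.
by rewrite /from; lia.
Qed.

End Perturbation.

(** * Recursive construction of the generator *)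

Section NormalForm.
Variables (K : numFieldType) (n : nat) (p : 'I_n -> nat).
Local Notation vfield := ('cV[fps K n]_n).
Variables (M : set vfield) (X X0 : vfield) (delta0 : int) (V : set vfield).
Hypothesis M_submodule : submodule M.
Hypothesis M_graded : graded p M.
Hypothesis M_ad :
  forall k W, homog_part p M k W -> forall Z, M Z -> M (bracket W Z).
Hypothesis MX : M X.
Hypothesis X0_qhomog : qhomog p delta0 X0.
Hypothesis X_init : forall k, k <= delta0 -> qpart p k (X - X0) = 0.
Hypothesis V_graded : graded p V.
Hypothesis V_compl : complement M [set bracket X0 Z | Z in M] V.
Implicit Types (Y Z U W : vfield).

(* M is only assumed stable under the homogeneous fields of M; the partial sums
   of the generator have this property. *)
Let stab Z : Prop := forall U, M U -> M (bracket Z U).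

(** Degree [k] only involves a finite partial sum, which lies in [M]; gradedness then extracts its
    part. *)
Lemma qpart_adflow_mem Z k :
  vsupp p (from 1) Z -> stab Z -> M (qpart p k (adflow p Z X)).
Proof.
move=> Z1 sZ; have [M0 MD MS] := M_submodule.
have Mpow l : M (ad_pow Z X l).
  by elim: l => [//|l IH]; apply: MS; exact: sZ.
set P := (\sum_i p i)%N; set N := (absz k + P).+1.
rewrite (qpart_eq_from (@adflow_trunc _ _ _ _ Z1 X N)); last first.
  by rewrite -/P /N; lia.
have MN : M (\sum_(l < N) ad_pow Z X l).
  by apply: big_ind => // l _; exact: Mpow.
by have [/(_ MN)/(_ k)[]] := M_graded (\sum_(l < N) ad_pow Z X l).
Qed.

Lemma subX0_order : vsupp p (from (delta0 + 1)) (X - X0).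
Proof.
apply: vsupp_qpart_eq0 => k; rewrite /from => kd; apply: X_init; lia.
Qed.

Lemma X0_homog : vsupp p (eq delta0) X0.
Proof. exact/qhomogP. Qed.

Lemma X_order : vsupp p (from delta0) X.
Proof.
rewrite -(subrK X0 X); apply: vsuppD.
  by apply: (vsuppW subX0_order) => a; rewrite /from; lia.
by apply: (vsuppW X0_homog) => a <-; rewrite /from.
Qed.

(** The complement splits the part of degree [k] as [Y + [X0, Z2]], and [z] is the part of [Z2] in
    degree [N.+1]. As [[z, X0] = - [X0, z]], the image term cancels in degree [k] and leaves a part
    of [Y], in [V] by gradedness. *)
Lemma homological_step (N : nat) Z : vsupp p (from 1) Z -> stab Z ->
  exists2 z, homog_part p M N.+1%:Z z &
    V (qpart p (delta0 + N.+1%:Z) (adflow p Z X) + bracket z X0).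
Proof.
move=> Z1 sZ; set k := delta0 + _; have [VM _ dec] := V_compl.
have [Y [_ [VY [Z2 MZ2 <-] E]]] := dec _ (@qpart_adflow_mem Z k Z1 sZ).
exists (qpart p N.+1 Z2); first by have [/(_ MZ2)/(_ N.+1%:Z)] := M_graded Z2.
have kN : k - delta0 = N.+1 by rewrite /k; lia.
have -> :
    qpart p k (adflow p Z X) + bracket (qpart p N.+1%:Z Z2) X0 = qpart p k Y.
  rewrite bracketC -kN -(qpart_bracket _ _ X0_homog).
  rewrite -(qpart_homog (@vsupp_qpart _ _ p k (adflow p Z X))).
  by rewrite -qpartB E addrK.
by have [/(_ VY)/(_ k)[]] := V_graded Y.
Qed.

Lemma generator_exists : exists Z : vfield, vsupp p (from 1) Z /\
  forall N : nat, exists Z1 z,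
    [/\ vsupp p (from 1) Z1 /\ vsupp p (eq N.+1%:Z) z, stab Z1,
        vsupp p (from N.+1%:Z) (Z - Z1), vsupp p (from N.+2%:Z) (Z - (Z1 + z))
      & V (qpart p (delta0 + N.+1%:Z) (adflow p Z1 X) + bracket z X0)].
Proof.
have [M0 MD _] := M_submodule.
have /choice[F FP] (NZ : nat * vfield) : exists z, vsupp p (from 1) NZ.2 ->
    stab NZ.2 -> homog_part p M NZ.1.+1%:Z z /\
      V (qpart p (delta0 + NZ.1.+1%:Z) (adflow p NZ.2 X) + bracket z X0).
  have [[Z1 sZ]|nZ] := pselect (vsupp p (from 1) NZ.2 /\ stab NZ.2).
    by have [z] := homological_step NZ.1 Z1 sZ; exists z.
  (* A default making [F] total; [inv] below shows that the recursion never meets this case. *)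
  by exists 0 => Z1 sZ; case: nZ.
pose Zs := fix Zs N := if N is N'.+1 then Zs N' + F (N', Zs N') else 0.
have inv N : vsupp p (from 1) (Zs N) /\ stab (Zs N).
  elim: N => [|N [Z1 sZ]].
    by split=> [|U _]; [exact: vsupp0 | rewrite bracket0l].
  have [MF _] := FP (N, Zs N) Z1 sZ; have [_ /qhomogP hF] := MF.
  split=> [|U MU].
    by apply: vsuppD => //; apply: (vsuppW hF) => a <-; rewrite /from /=; lia.
  by rewrite bracketDl; apply: MD; [exact: sZ | exact: (M_ad MF)].
have hF N : vsupp p (eq N.+1%:Z) (F (N, Zs N)).
  by have [Z1 sZ] := inv N; have [[_ /qhomogP]] := FP (N, Zs N) Z1 sZ.
have tail N j : vsupp p (from N.+1%:Z) (Zs (N + j)%N - Zs N).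
  elim: j => [|j IH]; first by rewrite addn0 subrr; exact: vsupp0.
  rewrite addnS /= addrAC; apply: vsuppD => //.
  by apply: (vsuppW (hF _)) => a <-; rewrite /from; lia.
(* The limit of the partial sums: a coefficient of [x^m] has degree at most [wdeg p m], while later
   sums differ from the one of that index only in higher degrees. *)
pose Z : vfield := \col_i Fps (fun m => Zs (absz (wdeg p m)) i 0 m).
have ZE i m : Z i 0 m = Zs (absz (wdeg p m)) i 0 m by rewrite mxE.
have lim N : vsupp p (from N.+1%:Z) (Z - Zs N).
  move=> i m; have -> : (Z - Zs N) i 0 m = Z i 0 m - Zs N i 0 m by rewrite !mxE.
  have [w wE] : exists w : nat, wdeg p m = w%:Z by exists (\sum_j p j * m j)%N.
  rewrite ZE wE /= => ne.
  have [Nw|wN] := leqP N w.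
    by rewrite -wE; apply: (tail N (w - N)%N i m); rewrite subnKC // !mxE.
  have ne' : (Zs (w + (N - w))%N - Zs w) i 0 m <> 0.
    rewrite subnKC 1?ltnW // !mxE => ne'.
    apply: ne; rewrite -opprB; move: ne'.
    by rewrite -[LHS]/(Zs N i 0 m - Zs w i 0 m) => ->; rewrite oppr0.
  have := tail w (N - w)%N i m ne'.
  by rewrite /from wE; lia.
exists Z; split; first by rewrite -[Z]subr0; exact: (lim 0%N).
move=> N; exists (Zs N), (F (N, Zs N)); have [Z1 sZ] := inv N.
split=> //.
by have [] := FP (N, Zs N) Z1 sZ.
Qed.

Lemma normal_form : exists Z : vfield,
  vsupp p (from 1) Z /\ V (adflow p Z X - X0).
Proof.
have [_ VB _] := V_compl.
have [Z [Zge1 HZ]] := generator_exists; exists Z; split=> //.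
have [_ VP] := V_graded (adflow p Z X - X0); apply: VP => k.
split; last by apply/qhomogP; exact: vsupp_qpart.
(* Up to degree [delta0] the field e^{ad Z} X agrees with [X], hence with [X0], and the part is
   zero. *)
rewrite qpartB; have [kd|kd] := leP k delta0.
  have E : vsupp p (from (delta0 + 1)) (adflow p Z X - X).
    have := @adflow_perturb _ _ p Z 0 X delta0 1 Zge1 (@vsupp0 _ _ _ _).
    rewrite subr0 adflow0 => /(_ Zge1 X_order) E.
    rewrite -(subrK (bracket Z X) (_ - X)); apply: vsuppD.
      by apply: (vsuppW E) => a; rewrite /from; lia.
    by apply: (vsupp_bracket Zge1 X_order) => a b; rewrite /from; lia.
  rewrite (qpart_eq_from E); last by lia.
  rewrite -qpartB X_init //.
  have : (V `&` [set bracket X0 Z | Z in M]) 0 by rewrite VB.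
  by case.
have [N kN] : exists N : nat, k = delta0 + N.+1%:Z.
  by exists (absz (k - delta0 - 1)%R); lia.
have [Z1 [z [[Z1ge1 hz] sZ1 ZZ1 ZZ1z]]] := HZ N.
rewrite -kN => Vk.
rewrite [qpart p k X0]qpart0 ?subr0; last first.
  by apply: (vsuppW X0_homog) => a <-; lia.
suff -> : qpart p k (adflow p Z X) =
  qpart p k (adflow p Z1 X) + bracket z X0 by [].
apply/eqP; rewrite -subr_eq -(@qpart_homog _ _ p k (bracket z X0)); last first.
  by apply: (vsupp_bracket hz X0_homog) => a b; lia.
rewrite -qpartB; apply/eqP; apply: (@qpart_eq_from _ _ _ (k + 1)); last by lia.
(* Three errors, each starting in degree [k + 1]: the nonlinear effect of [Z - Z1], the terms of [Z]
   after [z], and the bracket of [z] with the higher terms of [X]. *)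
have -> : adflow p Z X - bracket z X0 - adflow p Z1 X =
    (adflow p Z X - adflow p Z1 X - bracket (Z - Z1) X) +
    (bracket (Z - (Z1 + z)) X + bracket z (X - X0)).
  rewrite !(bracketBl, bracketBr, bracketDl).
  move: (adflow p Z X) (adflow p Z1 X) (bracket Z X) (bracket Z1 X).
  move: (bracket z X) => e a b c d; apply/matrixP => i j; rewrite !mxE; ring.
apply: vsuppD.
  apply: (vsuppW (adflow_perturb Zge1 Z1ge1 ZZ1 X_order)) => a.
  by rewrite /from; lia.
apply: vsuppD.
  by apply: (vsupp_bracket ZZ1z X_order) => a b; rewrite /from; lia.
by apply: (vsupp_bracket hz subX0_order) => a b; rewrite /from; lia.
Qed.

End NormalForm.

(** [Phi] is the time-one flow of [Z], and [Y] is what e^{ad Z} X adds to [X0]. [V] is graded in the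
    completed sense, so it contains [Y] once it contains each homogeneous part. *)
Theorem mainTheorem1 (R : realType) (n : nat) (p : 'I_n -> nat)
    (p_gt0 : forall i, (0 < p i)%N)
    (p_coprime : \big[gcdn/0%N]_(i < n) p i = 1%N)
    (M : set 'cV[fps R[i] n]_n)
    (M_submodule : submodule M)
    (M_graded : graded p M)
    (* ad_W maps M to M, for every quasi-homogeneous W in M *)
    (M_ad : forall k W, homog_part p M k W -> forall Z, M Z -> M (bracket W Z))
    (X X0 : 'cV[fps R[i] n]_n) (delta0 : int)
    (MX : M X)
    (X0_qhomog : qhomog p delta0 X0)
    (X_init : forall k, k <= delta0 -> qpart p k (X - X0) = 0)
    (V : set 'cV[fps R[i] n]_n)
    (V_subspace : subspace V)
    (V_graded : graded p V)
    (V_compl : complement M [set bracket X0 Z | Z in M] V) :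
  exists Y Phi : 'cV[fps R[i] n]_n,
    [/\ V Y, formal_diffeo Phi & pullback Phi X = X0 + Y].
Proof.
have [Z [Z_ge1 VZ]] :=
  normal_form M_submodule M_graded M_ad MX X0_qhomog X_init V_graded V_compl.
exists (adflow p Z X - X0), (flow_map p Z); split=> //.
  exact: flow_map_diffeo.
by rewrite pullback_flow_map // addrC subrK.
Qed.
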